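(* Every regular tree set is isomorphic (as a tree set) to a tree set of bipartitions of some set.
   Context: A separation system $(\vec S,\le,{}^* )$ is a poset with an order-reversing involution; write $\overleftarrow s=\vec s^{\,*}$. $\vec s$ is degenerate if $\vec s=\overleftarrow s$, small if $\vec s\le\overleftarrow s$, trivial if there is a separation $\{\vec t,\overleftarrow t\}$ with $\vec s<\vec t$ and $\vec s<\overleftarrow t$. Regular: no small elements. Essential: no trivial and no degenerate elements. Nested: any two separations $\{\vec r,\overleftarrow r\},\{\vec s,\overleftarrow s\}$ have comparable orientations. A tree set is a nested essential separation system; an isomorphism of tree sets is a bijection preserving the order in both directions and commuting with the involutions. A bipartition of a set $X$ is an ordered pair $(A,B)$ of disjoint nonempty sets with $A\cup B=X$. The bipartitions of $X$ form a separation system $\vec S(X)$ with order $(A,B)\le(C,D)$ iff $A\subseteq C$ and involution $(A,B)\mapsto(B,A)$. A tree set of bipartitions of $X$ is a subset of $\vec S(X)$ closed under the involution which, with the induced order and involution, is a tree set. *)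

(* Defs.v *)
From HB Require Import structures.
From mathcomp Require Import all_boot all_order.
From mathcomp Require Import boolp classical_sets.

Set Implicit Arguments.
Unset Strict Implicit.
Unset Printing Implicit Defensive.

Import Order.TTheory.
Local Open Scope order_scope.
Local Open Scope classical_set_scope.

(* An element of a separation system is an oriented separation s; the
   separation itself is the unordered pair {s, sep_inv s}. *)
HB.mixin Record isSeparationSystem d T of Order.POrder d T := {
  sep_inv : T -> T;
  sep_invK : involutive sep_inv;
  sep_inv_le : forall r s : T, r <= s -> sep_inv s <= sep_inv r;
}.

#[short(type="sepSystemType")]
HB.structure Definition SeparationSystem d :=
  { T of isSeparationSystem d T & Order.POrder d T }.

Section Notions.
Variables (d : Order.disp_t) (S : sepSystemType d).
Implicit Types r s t : S.

Definition degenerate s : Prop := s = sep_inv s.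

Definition small s : Prop := s <= sep_inv s.

Definition trivial_sep s : Prop := exists t, s < t /\ s < sep_inv t.

Definition comparable_orientations r s : Prop :=
  [\/ r >=< s, r >=< sep_inv s, sep_inv r >=< s | sep_inv r >=< sep_inv s].

End Notions.

Definition regular d (S : sepSystemType d) : Prop := forall s : S, ~ small s.

Definition essential d (S : sepSystemType d) : Prop :=
  forall s : S, ~ trivial_sep s /\ ~ degenerate s.

Definition nested d (S : sepSystemType d) : Prop :=
  forall r s : S, comparable_orientations r s.

Definition tree_set d (S : sepSystemType d) : Prop := nested S /\ essential S.

Definition tree_set_iso d (S : sepSystemType d) d' (S' : sepSystemType d')
    (f : S -> S') : Prop :=
  [/\ bijective f, {mono f : r s / r <= s} & {morph f : s / sep_inv s}].

Definition isomorphic d (S : sepSystemType d) d' (S' : sepSystemType d') : Prop :=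
  exists f : S -> S', tree_set_iso f.

Definition inv_closed d (S : sepSystemType d) (A : set S) : Prop :=
  forall s, A s -> A (sep_inv s).

(* A subset closed under the involution, with the induced order and involution.
   The alias carries the closure proof so that the instances can be inferred. *)
Definition induced d (S : sepSystemType d) (A : set S) of inv_closed A : Type :=
  set_type A.

Section Induced.
Variables (d : Order.disp_t) (S : sepSystemType d) (A : set S).
Variable hA : inv_closed A.
Local Notation I := (induced hA).

HB.instance Definition _ := SubChoice.copy I (set_type A).
HB.instance Definition _ := [SubChoice_isSubPOrder of I by <: with d].

Definition induced_inv (s : I) : I :=
  exist _ (sep_inv (val s)) (mem_set (hA (set_mem (valP s)))).

Lemma induced_invK : involutive induced_inv.
Proof. by move=> s; apply: val_inj; rewrite /= sep_invK. Qed.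

Lemma induced_inv_le (r s : I) : r <= s -> induced_inv s <= induced_inv r.
Proof. by rewrite -!Order.le_val; apply: sep_inv_le. Qed.

HB.instance Definition _ :=
  isSeparationSystem.Build d I induced_invK induced_inv_le.

End Induced.

Definition is_bipartition (X : Type) (p : set X * set X) : Prop :=
  [/\ p.1 !=set0, p.2 !=set0, p.1 `&` p.2 = set0 & p.1 `|` p.2 = setT].

Definition bipartition (X : Type) : Type :=
  {p : set X * set X | `[< is_bipartition p >]}.

Section Bipartitions.
Variable X : Type.
Local Notation B := (bipartition X).
Implicit Types p q : B.

HB.instance Definition _ := SubChoice.on B.

Definition bip_le p q : bool := `[< (val p).1 `<=` (val q).1 >].

Lemma bipP p : is_bipartition (val p).
Proof. exact/asboolP/(valP p). Qed.

Lemma bip_setC p : (val p).2 = ~` (val p).1.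
Proof.
have [_ _ dis cov] := bipP p; apply/seteqP; split=> x.
  by move=> p2 p1; have : set0 x by rewrite -dis.
by move=> np1; have : setT x by []; rewrite -cov => -[].
Qed.

Lemma bip_le_refl : reflexive bip_le.
Proof. by move=> p; apply/asboolP. Qed.

Lemma bip_le_anti : antisymmetric bip_le.
Proof.
move=> p q /andP[/asboolP pq /asboolP qp].
have e1 : (val p).1 = (val q).1 by apply/seteqP.
apply: val_inj; rewrite [LHS]surjective_pairing [RHS]surjective_pairing.
by rewrite !bip_setC e1.
Qed.

Lemma bip_le_trans : transitive bip_le.
Proof.
by move=> q p r /asboolP pq /asboolP qr; apply/asboolP; apply: subset_trans qr.
Qed.

HB.instance Definition _ :=
  Order.Le_isPOrder.Build set_display B bip_le_refl bip_le_anti bip_le_trans.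

Lemma bip_swap p : is_bipartition ((val p).2, (val p).1).
Proof. by have [? ? ? ?] := bipP p; split=> //=; rewrite (setIC, setUC). Qed.

Definition bip_inv p : B := exist _ ((val p).2, (val p).1) (asboolT (bip_swap p)).

Lemma bip_invK : involutive bip_inv.
Proof. by move=> p; apply: val_inj; rewrite /= -surjective_pairing. Qed.

Lemma bip_inv_le p q : p <= q -> bip_inv q <= bip_inv p.
Proof.
by move=> /asboolP pq; apply/asboolP; rewrite /= !bip_setC; apply: subsetC.
Qed.

HB.instance Definition _ :=
  isSeparationSystem.Build set_display B bip_invK bip_inv_le.

End Bipartitions.

(* Main.v *)
Require Import Defs.
From mathcomp Require Import all_boot all_order.
From mathcomp Require Import boolp classical_sets.

(** In a regular tree set T each x has a unique consistent orientation of T in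
    which x is minimal: it consists of the s with x <= s or x^* < s.  Taking for
    the ground set T itself, each x standing for this orientation, send s to the
    bipartition of T into the x whose orientation contains s and the x whose
    orientation contains s^*.  Nestedness gives the separating points: if s <= t
    fails, then the orientation given by s or the one given by t^* contains both
    s and t^*. *)

Set Implicit Arguments.
Unset Strict Implicit.
Unset Printing Implicit Defensive.

Import Order.TTheory.
Local Open Scope order_scope.
Local Open Scope classical_set_scope.

Section SeparationSystems.
Variables (d : Order.disp_t) (S : sepSystemType d).
Implicit Types r s t : S.

Lemma sep_inv_leE r s : (sep_inv s <= sep_inv r) = (r <= s).
Proof.
by apply/idP/idP => /sep_inv_le; rewrite ?sep_invK.
Qed.

Lemma sep_inv_ltE r s : (sep_inv s < sep_inv r) = (r < s).
Proof. by rewrite !lt_leAnge !sep_inv_leE. Qed.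

(** The involution reverses the order, so it identifies the eight possible comparabilities in
    pairs. *)
Lemma nested_cases : nested S -> forall r s,
  [\/ r <= s, s <= r, r <= sep_inv s | sep_inv r <= s].
Proof.
have le_invC r s : (r <= sep_inv s) = (s <= sep_inv r).
  by rewrite -sep_inv_leE sep_invK.
have inv_leC r s : (sep_inv r <= s) = (sep_inv s <= r).
  by rewrite -sep_inv_leE sep_invK.
move=> nest r s; case: (nest r s) => /orP[] h.
- exact: Or41.
- exact: Or42.
- exact: Or43.
- by apply: Or44; rewrite inv_leC.
- exact: Or44.
- by apply: Or43; rewrite le_invC.
- by apply: Or42; rewrite -sep_inv_leE.
- by apply: Or41; rewrite -sep_inv_leE.
Qed.

End SeparationSystems.

(** This spares a direct check on the bipartitions: they inherit nestedness and essentiality from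
    [T]. *)
Lemma tree_set_iso_tree_set d (S : sepSystemType d) d' (S' : sepSystemType d')
    (f : S -> S') : tree_set_iso f -> tree_set S -> tree_set S'.
Proof.
case=> -[g fK gK] f_le f_inv [nest ess].
have f_lt r s : (f r < f s) = (r < s) by rewrite !lt_leAnge !f_le.
split=> [r s|s].
  rewrite -(gK r) -(gK s) /comparable_orientations /Order.comparable -!f_inv.
  by rewrite !f_le; apply: nest.
rewrite -(gK s); have [ntriv ndeg] := ess (g s); split.
  case=> t; rewrite -(gK t) -f_inv !f_lt => ht.
  by apply: ntriv; exists (g t).
by rewrite /degenerate -f_inv => /(can_inj fK).
Qed.

Lemma inv_closed_range d (S : sepSystemType d) d' (S' : sepSystemType d')
    (f : S -> S') : {morph f : s / sep_inv s} -> inv_closed (range f).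
Proof. by move=> f_inv _ [s _ <-]; exists (sep_inv s). Qed.

Lemma isomorphic_range d (S : sepSystemType d) d' (S' : sepSystemType d')
    (f : S -> S') (f_inv : {morph f : s / sep_inv s}) :
  {mono f : r s / r <= s} -> isomorphic S (induced (inv_closed_range f_inv)).
Proof.
(* Reflecting the order forces injectivity, by antisymmetry. *)
move=> f_le; have f_inj : injective f.
  by move=> r s e; apply/le_anti; rewrite -!f_le e lexx.
pose F s : induced (inv_closed_range f_inv) :=
  exist _ (f s) (mem_set (imageP f I)).
have F_ex y : exists s, F s = y.
  by have [s _ fs] := set_mem (valP y); exists s; apply: val_inj.
exists F; split=> [|r s|s].
- exists (fun y => projT1 (cid (F_ex y))) => [s|y].
    by case: cid => r /= /(congr1 val) /f_inj.
  by case: cid.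
- by rewrite -Order.le_val /= f_le.
- by apply: val_inj; rewrite /= f_inv.
Qed.

Section RegularTreeSets.
Variables (d : Order.disp_t) (T : sepSystemType d).
Hypotheses (regT : regular T) (treeT : tree_set T).
Implicit Types s t x : T.

(** The second inequality is strict so as to exclude [sep_inv x] itself. *)
Definition orients x s : Prop := x <= s \/ sep_inv x < s.

Lemma orients_total x s : orients x s \/ orients x (sep_inv s).
Proof.
have [nest _] := treeT.
case: (nested_cases nest x s) => h.
- by left; left.
- move: h; rewrite le_eqVlt => /predU1P[->|sx]; first by left; left.
  by right; right; rewrite sep_inv_ltE.
- by right; left.
- move: h; rewrite le_eqVlt => /predU1P[<-|xs]; last by left; right.
  by right; left; rewrite sep_invK.
Qed.

(** If [s] and its inverse are in the orientation for the same reason, then [x] or [sep_inv x] is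
    trivial; if for different reasons, a strict cycle arises. *)
Lemma orients_asym x s : orients x s -> ~ orients x (sep_inv s).
Proof.
have [_ ess] := treeT.
case=> xs []; rewrite ?sep_inv_ltE.
- move=> xs'; have [ntriv _] := ess x; apply: ntriv; exists s.
  (* Triviality needs strict inequalities: equality of [x] with [s] or [sep_inv s] would make [x]
     small. *)
  rewrite !lt_neqAle xs xs' !andbT; split; apply/eqP => e; apply: (@regT x).
    by rewrite /small {2}e.
  by rewrite /small {2}e sep_invK.
- by move=> sx; have := le_lt_trans xs sx; rewrite ltxx.
- rewrite -sep_inv_leE sep_invK => sx.
  by have := lt_le_trans xs sx; rewrite ltxx.
- rewrite -{1}[x]sep_invK => sx; have [ntriv _] := ess (sep_inv x).
  by apply: ntriv; exists s; split=> //; rewrite -sep_inv_ltE !sep_invK -[x]sep_invK.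
Qed.

Lemma orients_inv x s : orients x (sep_inv s) <-> ~ orients x s.
Proof.
split=> [xs' xs|nxs]; first exact: orients_asym xs xs'.
by case: (orients_total x s).
Qed.

Lemma orients_le s t : s <= t <-> (forall x, orients x s -> orients x t).
Proof.
split=> [st x [xs|xs]|st]; first by left; apply: le_trans st.
  by right; apply: lt_le_trans st.
have [nest _] := treeT; case: (nested_cases nest s t) => h //.
- have /st : orients s s by left.
  (* If [t < s], the point [s] orients [sep_inv t] too, since [sep_inv s < sep_inv t]. *)
  case=> // st'; move: h; rewrite le_eqVlt => /predU1P[->//|ts].
  by have /orients_inv[] : orients s (sep_inv t); [right; rewrite sep_inv_ltE | right].
- have ss : orients s s by left.
  by have /orients_inv/(_ (st _ ss)) : orients s (sep_inv t) by left.
(* Here [sep_inv t <= s], so the separating point is [sep_inv t]. *)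
- have ts : orients (sep_inv t) s by left; rewrite -sep_inv_leE sep_invK.
  by have /orients_inv/(_ (st _ ts)) : orients (sep_inv t) (sep_inv t) by left.
Qed.

Lemma orients_bipartition s :
  is_bipartition ([set x | orients x s], [set x | orients x (sep_inv s)]).
Proof.
split=> /=.
(* Each side is nonempty because every element orients itself. *)
- by exists s; left.
- by exists (sep_inv s); left.
- by apply/seteqP; split=> // x [/= xs /orients_inv].
- by apply/seteqP; split=> // x _; apply: orients_total.
Qed.

Definition orientation_bip s : bipartition T :=
  exist _ ([set x | orients x s], [set x | orients x (sep_inv s)])
    (asboolT (orients_bipartition s)).

Lemma orientation_bip_le : {mono orientation_bip : s t / s <= t}.
Proof. by move=> s t; apply/asboolP/idP => /orients_le. Qed.

Lemma orientation_bip_inv : {morph orientation_bip : s / sep_inv s}.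
Proof. by move=> s; apply: val_inj; rewrite /= sep_invK. Qed.

End RegularTreeSets.

Theorem theorem5p1 (d : Order.disp_t) (T : sepSystemType d)
    (regT : regular T) (treeT : tree_set T) :
  exists (X : Type) (A : set (bipartition X)) (hA : inv_closed A),
    tree_set (induced hA) /\ isomorphic T (induced hA).
Proof.
exists T, (range (orientation_bip regT treeT)).
exists (inv_closed_range (orientation_bip_inv regT treeT)).
have iso := isomorphic_range (orientation_bip_inv regT treeT)
              (orientation_bip_le regT treeT).
split=> //; have [f f_iso] := iso.
exact: tree_set_iso_tree_set f_iso treeT.
Qed.
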